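(* Let $d\ge 1$ be an integer and let $H$ be a real inner product space with $\dim(H)=d+1$. Let $\{v_1,\dots,v_{d+1}\}$ be a basis of $H$, and let $u\in H$ be of the form $u=\sum_{i=1}^{d+1}t_iv_i$ with all $t_i\ge 0$, such that $u$ is not a scalar multiple of any single $v_i$ (in particular $u\ne 0$). Let $\beta_1,\dots,\beta_{d+1}>0$ be arbitrary, write $u=\sum_{i=1}^{d+1}\lambda_i\beta_iv_i$, and set $\tilde u=\left(\sum_{i=1}^{d+1}\lambda_i\right)^{-1}u$. Then $$\mathrm{p}_d\mathrm{sin}_0(v_1,\dots,v_{d+1})=\sum_{i=1}^{d+1}P_i\cdot\mathrm{p}_d\mathrm{sin}_0(v_1,\dots,v_{i-1},u,v_{i+1},\dots,v_{d+1}),\qquad P_i=\frac{\|\tilde u\|}{\|\beta_iv_i\|}.$$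
   Context: Fix an orthonormal basis $\Phi$ of $H$ and let $\det$ be the determinant function with respect to $\Phi$ (the alternating multilinear function with value $1$ on $\Phi$). For $\dim(H)=d+1$, the signed polar sine is $\mathrm{p}_d\mathrm{sin}_0(w_1,\dots,w_{d+1})=\dfrac{\det(w_1,\dots,w_{d+1})}{\prod_{j=1}^{d+1}\|w_j\|}$, with value $0$ if the denominator is $0$. *)

(* Defs.v *)
From HB Require Import structures.
From mathcomp Require Import all_boot all_order all_algebra perm.
From mathcomp Require Import sesquilinear reals.

Set Implicit Arguments.
Unset Strict Implicit.
Unset Printing Implicit Defensive.

Import Order.TTheory GRing.Theory Num.Theory.
Local Open Scope ring_scope.

(* (w_1, ..., w_(i-1), x, w_(i+1), ..., w_n) *)
Definition subst_tuple (T : Type) (n : nat) (w : n.-tuple T) (i : 'I_n) (x : T)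
    : n.-tuple T :=
  [tuple if j == i then x else tnth w j | j < n].

Definition multilinear_fun (R : realType) (H : vectType R) (n : nat)
    (D : n.-tuple H -> R) : Prop :=
  forall (w : n.-tuple H) (i : 'I_n) (a : R) (x y : H),
    D (subst_tuple w i (a *: x + y)) =
      a * D (subst_tuple w i x) + D (subst_tuple w i y).

Definition alternating_fun (R : realType) (H : vectType R) (n : nat)
    (D : n.-tuple H -> R) : Prop :=
  forall (w : n.-tuple H) (i j : 'I_n),
    i != j -> tnth w i = tnth w j -> D w = 0.

(* The determinant function with respect to Phi, computed from coordinates;
   vdetP below shows that, when Phi is a basis, it is the unique alternating
   multilinear function with value 1 on Phi. *)
Definition vdet (R : realType) (H : vectType R) (n : nat)
    (Phi : n.-tuple H) (w : n.-tuple H) : R :=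
  \det (\matrix_(i < n, j < n) coord Phi j (tnth w i)).

Definition dnorm (R : realType) (H : vectType R) (dotp : {dot H for idfun})
    (x : H) : R := Num.sqrt (dotp x x).

(* p_d sin_0 of the d.+1 vectors w, relative to the orthonormal basis Phi. *)
Definition psin0 (R : realType) (H : vectType R) (dotp : {dot H for idfun})
    (d : nat) (Phi w : d.+1.-tuple H) : R :=
  let den := \prod_(j < d.+1) dnorm dotp (tnth w j) in
  if den == 0 then 0 else vdet Phi w / den.

Section VDet.
Variables (R : realType) (H : vectType R) (n : nat).
Implicit Types (w Phi : n.-tuple H) (D : n.-tuple H -> R).

Let tnth_subst w i x j :
  tnth (subst_tuple w i x) j = if j == i then x else tnth w j.
Proof. by rewrite tnth_mktuple. Qed.

Let subst_id w i : subst_tuple w i (tnth w i) = w.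
Proof. by apply: eq_from_tnth => j; rewrite tnth_subst; case: eqP => // ->. Qed.

Lemma vdet_multilinear Phi : multilinear_fun (vdet Phi).
Proof.
move=> w i a x y; rewrite /vdet -[X in _ = _ + X]mul1r.
apply: (determinant_multilinear (i0 := i)).
- by apply/rowP => j; rewrite !mxE !tnth_subst eqxx linearP mul1r.
- apply/matrixP => k j; rewrite !mxE !tnth_subst.
  by rewrite eq_sym (negbTE (neq_lift i k)).
- apply/matrixP => k j; rewrite !mxE !tnth_subst.
  by rewrite eq_sym (negbTE (neq_lift i k)).
Qed.

Lemma vdet_alternating Phi : alternating_fun (vdet Phi).
Proof.
move=> w i j neq_ij eq_w; rewrite /vdet.
by apply: (determinant_alternate neq_ij) => k; rewrite !mxE eq_w.
Qed.

Lemma vdet_id Phi : basis_of {:H} Phi -> vdet Phi Phi = 1.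
Proof.
move=> /basis_free fPhi; rewrite /vdet -[RHS](det1 R n); congr (\det _).
by apply/matrixP => i j; rewrite !mxE (tnth_nth 0) coord_free.
Qed.

Let multilinear_sum D : multilinear_fun D ->
  forall w i (c : 'I_n -> R) (x : 'I_n -> H),
    D (subst_tuple w i (\sum_j c j *: x j)) =
    \sum_j c j * D (subst_tuple w i (x j)).
Proof.
move=> mD w i c x.
have D0 : D (subst_tuple w i 0) = 0.
  have := mD w i (-1) 0 0; rewrite scaler0 addr0 => ->.
  by rewrite mulN1r addNr.
elim/big_rec2: _ => [|j s t _ IH]; first exact: D0.
by rewrite mD IH.
Qed.

Let alternating_swap D : multilinear_fun D -> alternating_fun D ->
  forall w (i j : 'I_n), i != j ->
    D [tuple tnth w (tperm i j k) | k < n] = - D w.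
Proof.
move=> mD aD w i j nij; have nji : j != i by rewrite eq_sym.
pose W x y := subst_tuple (subst_tuple w i x) j y.
have WW x y : W x y = subst_tuple (subst_tuple w j y) i x.
  apply: eq_from_tnth => k; rewrite !tnth_subst.
  by have [->|] := eqVneq k j; rewrite ?(negbTE nji) ?eqxx.
have W0 x : D (W x x) = 0.
  apply: (aD _ _ _ nij); rewrite !tnth_subst !eqxx (negbTE nij).
  by [].
have addr_ x y z : D (W z (x + y)) = D (W z x) + D (W z y).
  by rewrite -[x in LHS]scale1r [LHS]mD mul1r.
have addl_ x y z : D (W (x + y) z) = D (W x z) + D (W y z).
  by rewrite !WW -[x in LHS]scale1r [LHS]mD mul1r.
have := W0 (tnth w i + tnth w j).
rewrite addr_ !addl_ !W0 add0r addr0 => /eqP; rewrite addr_eq0 => /eqP E.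
have -> : [tuple tnth w (tperm i j k) | k < n] = W (tnth w j) (tnth w i).
  apply: eq_from_tnth => k; rewrite tnth_mktuple !tnth_subst.
  have [->|nkj] := eqVneq k j; first by rewrite tpermR.
  have [->|nki] := eqVneq k i; first by rewrite tpermL.
  by rewrite tpermD // eq_sym.
rewrite E; congr (- D _); apply: eq_from_tnth => k; rewrite !tnth_subst.
by have [->|nkj] := eqVneq k j; [|have [->|] := eqVneq k i].
Qed.

Let alternating_perm D : multilinear_fun D -> alternating_fun D ->
  forall w (s : 'S_n), D [tuple tnth w (s k) | k < n] = (-1) ^+ s * D w.
Proof.
move=> mD aD w s; have [ts -> dts] := prod_tpermP s.
elim: ts dts w => [_ w|[i j] ts IH /= /andP[nij dts] w].
  rewrite big_nil odd_perm1 mul1r; congr D; apply: eq_from_tnth => k.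
  by rewrite tnth_mktuple perm1.
rewrite big_cons odd_mul_tperm nij signr_addb mulN1r mulNr -IH //.
rewrite -(alternating_swap mD aD _ nij); congr D.
by apply: eq_from_tnth => k; rewrite !tnth_mktuple permM.
Qed.

Lemma vdetP Phi D : basis_of {:H} Phi ->
  multilinear_fun D /\ alternating_fun D /\ D Phi = 1 <->
  (forall w, D w = vdet Phi w).
Proof.
move=> bPhi; split; last first.
  move=> E; split; first by move=> w i a x y; rewrite !E; exact: vdet_multilinear.
  split; last by rewrite E vdet_id.
  by move=> w i j nij ew; rewrite E (vdet_alternating _ nij ew).
move=> [mD [aD D1]].
have onPhi (f : 'I_n -> 'I_n) :
    D [tuple tnth Phi (f k) | k < n] = vdet Phi [tuple tnth Phi (f k) | k < n].
  have [/injectiveP injf|/injectivePn[i [j nij fij]]] := boolP (injectiveb f).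
    have -> : [tuple tnth Phi (f k) | k < n] =
              [tuple tnth Phi (perm injf k) | k < n].
      by apply: eq_from_tnth => k; rewrite !tnth_mktuple permE.
    rewrite (alternating_perm mD aD) D1.
    by rewrite (alternating_perm (@vdet_multilinear _) (@vdet_alternating _))
               vdet_id.
  by rewrite (aD _ _ _ nij) ?(vdet_alternating _ nij) // !tnth_mktuple fij.
have main k w : (forall i : 'I_n, (k <= i)%N -> exists j, tnth w i = tnth Phi j) ->
    D w = vdet Phi w.
  elim: k w => [|k IH] w wPhi.
    have /fin_all_exists[f fE] : forall i, exists j, tnth w i = tnth Phi j.
      by move=> i; apply: wPhi.
    suff -> : w = [tuple tnth Phi (f k) | k < n] by exact: onPhi.
    by apply: eq_from_tnth => k; rewrite tnth_mktuple.
  have [kn|nk] := ltnP k n; last first.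
    by apply: IH => i ki; have := leq_trans nk ki; rewrite leqNgt ltn_ord.
  pose i0 := Ordinal kn.
  rewrite -(subst_id w i0) (coord_basis bPhi (memvf (tnth w i0))).
  rewrite (multilinear_sum mD) (multilinear_sum (@vdet_multilinear Phi)).
  apply: eq_bigr => j _; congr (_ * _); apply: IH => i ki.
  rewrite tnth_subst; case: (eqVneq i i0) => [_|nii].
    by exists j; rewrite (tnth_nth 0).
  apply: wPhi; rewrite ltn_neqAle ki andbT; apply: contra nii => /eqP ki'.
  by apply/eqP/val_inj.
by move=> w; apply: (main n w) => i; rewrite leqNgt ltn_ord.
Qed.

End VDet.

(* Main.v *)
(** Write [u = \sum_i t_i v_i], so that [t_i = lambda_i beta_i]. By Cramer's rule,
    replacing [v_i] by [u] multiplies the determinant by [t_i], while it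
    multiplies the product of the norms by [|u| / |v_i|]. Hence the i-th summand is
    [lambda_i / (\sum_j lambda_j)] times the signed polar sine of [v], and these
    weights add up to 1; nonnegativity of the [t_i] and [u <> 0] make
    [\sum_j lambda_j] positive. *)
Require Import Defs.
From HB Require Import structures.
From mathcomp Require Import all_boot all_order all_algebra.
From mathcomp Require Import sesquilinear reals.
From mathcomp Require Import ring.

Set Implicit Arguments.
Unset Strict Implicit.
Unset Printing Implicit Defensive.

Import Order.TTheory GRing.Theory Num.Theory.
Local Open Scope ring_scope.

Section DNorm.
Variables (R : realType) (H : vectType R) (dotp : {dot H for idfun}).

Lemma dnorm_neq0 (x : H) : x != 0 -> dnorm dotp x != 0.
Proof. by move=> x0; rewrite /dnorm gt_eqF // sqrtr_gt0 neq0_dnorm_gt0. Qed.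

Lemma dnorm_scale (a : R) (x : H) : dnorm dotp (a *: x) = `|a| * dnorm dotp x.
Proof.
rewrite /dnorm linearZl_LR linearZr_LR /= mulrA -expr2.
by rewrite sqrtrM ?sqr_ge0 // sqrtr_sqr.
Qed.

End DNorm.

Section SubstTuple.
Variables (R : realType) (H : vectType R) (n : nat).
Implicit Types (w : n.-tuple H) (D : n.-tuple H -> R).

Lemma tnth_subst_tuple w (i j : 'I_n) (x : H) :
  tnth (subst_tuple w i x) j = if j == i then x else tnth w j.
Proof. by rewrite tnth_mktuple. Qed.

Lemma subst_tuple_id w (i : 'I_n) : subst_tuple w i (tnth w i) = w.
Proof.
by apply: eq_from_tnth => j; rewrite tnth_subst_tuple; case: eqP => // ->.
Qed.

Lemma multilinear_subst_sum D w (i : 'I_n) (c : 'I_n -> R) (x : 'I_n -> H) :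
  multilinear_fun D ->
  D (subst_tuple w i (\sum_j c j *: x j)) =
    \sum_j c j * D (subst_tuple w i (x j)).
Proof.
move=> mD; elim/big_rec2: _ => [|j s t _ IH]; last by rewrite mD IH.
(* The empty sum: linearity with scalar [-1] at zero vectors says that the value at [0] equals its
   own negative plus itself, hence is [0]. *)
by have := mD w i (-1) 0 0; rewrite scaler0 addr0 mulN1r addNr.
Qed.

(** Expanding slot [i] by linearity, each term with [j != i] has [tnth w j] in both slots [i] and
    [j], so it vanishes; only the term [j = i] survives. *)
Lemma alternating_cramer D w (i : 'I_n) (c : 'I_n -> R) :
  multilinear_fun D -> alternating_fun D ->
  D (subst_tuple w i (\sum_j c j *: tnth w j)) = c i * D w.
Proof.
move=> mD aD; rewrite multilinear_subst_sum // (bigD1 i) //= subst_tuple_id.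
rewrite big1 ?addr0 // => j ji; rewrite (aD _ _ _ ji) ?mulr0 //.
by rewrite !tnth_subst_tuple eqxx (negbTE ji).
Qed.

(** Both sides share the norms outside slot [i]. The division-free form avoids assuming [tnth w i]
    nonzero. *)
Lemma prod_dnorm_subst (dotp : {dot H for idfun}) w (i : 'I_n) (x : H) :
  (\prod_j dnorm dotp (tnth (subst_tuple w i x) j)) * dnorm dotp (tnth w i) =
    dnorm dotp x * \prod_j dnorm dotp (tnth w j).
Proof.
rewrite (bigD1 i) //= [in RHS](bigD1 i) //= tnth_subst_tuple eqxx.
rewrite mulrAC -mulrA; congr (_ * (_ * _)); apply: eq_bigr => j ji.
by rewrite tnth_subst_tuple (negbTE ji).
Qed.

End SubstTuple.

(* The case distinction in psin0 is redundant: division by 0 gives 0. *)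
Lemma psin0E (R : realType) (H : vectType R) (dotp : {dot H for idfun}) (d : nat)
    (Phi w : d.+1.-tuple H) :
  psin0 dotp Phi w = vdet Phi w / \prod_j dnorm dotp (tnth w j).
Proof. by rewrite /psin0; case: eqP => // ->; rewrite invr0 mulr0. Qed.

Theorem mainTheorem4
    (R : realType) (d : nat) (d_ge1 : (1 <= d)%N)
    (H : vectType R) (dotp : {dot H for idfun}) (dimH : \dim {:H} = d.+1)
    (Phi : d.+1.-tuple H)
    (Phi_basis : basis_of {:H} Phi) (Phi_orthonormal : orthonormal dotp Phi)
    (v : d.+1.-tuple H) (v_basis : basis_of {:H} v)
    (u : H) (t : 'I_d.+1 -> R)
    (u_def : u = \sum_(i < d.+1) t i *: tnth v i)
    (t_ge0 : forall i, 0 <= t i)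
    (u_not_multiple : forall (i : 'I_d.+1) (c : R), u <> c *: tnth v i)
    (beta : 'I_d.+1 -> R) (beta_gt0 : forall i, 0 < beta i)
    (lambda : 'I_d.+1 -> R)
    (u_lambda : u = \sum_(i < d.+1) (lambda i * beta i) *: tnth v i) :
  let utilde : H := (\sum_(i < d.+1) lambda i)^-1 *: u in
  let P (i : 'I_d.+1) : R :=
    dnorm dotp utilde / dnorm dotp (beta i *: tnth v i) in
  psin0 dotp Phi v =
    \sum_(i < d.+1) P i * psin0 dotp Phi (subst_tuple v i u).
Proof.
move=> utilde P; have fv := basis_free v_basis.
have v_neq0 i : tnth v i != 0 by exact/(free_not0 fv)/mem_tnth.
have u_neq0 : u != 0.
  by apply/eqP => u0; apply: (u_not_multiple ord0 0); rewrite scale0r.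
have t_lambda i : t i = lambda i * beta i.
  (* The differences of the two coefficient families combine the free family [v] to [u - u = 0], so
     they all vanish. *)
  apply/eqP; rewrite -subr_eq0; apply/eqP; move: i.
  move/freeP: fv; apply.
  under eq_bigr do rewrite -tnth_nth scalerBl.
  by rewrite sumrB -u_def -u_lambda subrr.
have lambda_ge0 i : 0 <= lambda i by rewrite -(pmulr_lge0 _ (beta_gt0 i)) -t_lambda.
set L := \sum_(i < d.+1) lambda i in utilde P *.
have L_gt0 : 0 < L.
  (* If [L] were [0], every nonnegative [lambda i] would be [0], forcing [u = 0]. *)
  rewrite lt_def sumr_ge0 // andbT; apply: contra u_neq0 => /eqP L0.
  rewrite u_lambda big1 // => i _.
  by rewrite (psumr_eq0P (fun i _ => lambda_ge0 i) L0) // mul0r scale0r.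
have term i : P i * psin0 dotp Phi (subst_tuple v i u) =
    lambda i / L * psin0 dotp Phi v.
  rewrite !psin0E [in vdet _ _]u_lambda.
  rewrite (alternating_cramer _ _ _ (@vdet_multilinear _ _ _ Phi)
             (@vdet_alternating _ _ _ Phi)).
  have prod_neq0 : \prod_j dnorm dotp (tnth v j) != 0.
    by apply/prodf_neq0 => j _; exact: dnorm_neq0.
  (* Multiplying and dividing the substituted product by the norm of [tnth v i] exposes the left
     side of [prod_dnorm_subst]. *)
  rewrite -[X in _ / X](mulfK (dnorm_neq0 dotp (v_neq0 i))) prod_dnorm_subst.
  rewrite /P /utilde !dnorm_scale !gtr0_norm ?invr_gt0 ?beta_gt0 //.
  (* The [beta i] from Cramer's rule cancels the one in the denominator of [P i], and the norms of
     [u] and [tnth v i] cancel too. *)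
  by field; rewrite prod_neq0 !dnorm_neq0 // !gt_eqF.
by rewrite (eq_bigr _ (fun i _ => term i)) -!mulr_suml divff ?mul1r // gt_eqF.
Qed.
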